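(* Let $n\ge 0$ be an integer. For integers $1\le a\le b\le n$ put $$V_{a,b}:=\{(x,y)\in\mathcal{Q}(n): a\le x\le b,\ 0\le y\le n-b\},$$ and for integers $0\le c\le d\le n$ put $$H_{c,d}:=\{(x,y)\in\mathcal{Q}(n): 0\le x\le n-d,\ c\le y\le d\}.$$ Then the meet-irreducible elements of the lattice $\mathcal{R}(n)$ (ordered by inclusion) are exactly the sets $\mathcal{Q}(n)\setminus V_{a,b}$ with $1\le a\le b\le n$ and $\mathcal{Q}(n)\setminus H_{c,d}$ with $0\le c\le d\le n$. In particular, the number of meet-irreducible elements is $(n+1)^2$.
   Context: For an integer $n\ge 0$, let $\mathcal{Q}(n)=\{(x,y)\in\mathbb{Z}^2: 0\le x,\ 0\le y,\ x+y\le n\}$. Let $\mathcal{R}(n)$ be the set of all subsets $Y\subseteq\mathcal{Q}(n)$ such that: for any $(a,b),(c,d)\in Y$ with $\max(a,c)+\max(b,d)\le n+1$, we have $(\min(a,c),\min(b,d))\in Y$ and, additionally, $(\max(a,c),\max(b,d))\in Y$ as soon as $(\max(a,c),\max(b,d))\in\mathcal{Q}(n)$. Ordered by inclusion, $\mathcal{R}(n)$ is a finite lattice with maximum $\mathcal{Q}(n)$; its meet is intersection, and the join of $X,Y$ is the intersection of all elements of $\mathcal{R}(n)$ containing $X\cup Y$. An element $Y\in\mathcal{R}(n)$ is meet-irreducible if and only if $Y\ne\mathcal{Q}(n)$ and $Y$ has a unique cover in $\mathcal{R}(n)$ (the maximum $\mathcal{Q}(n)$ is not counted as meet-irreducible).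 *)

(* Defs.v *)
From HB Require Import structures.
From mathcomp Require Import all_boot all_order.

Set Implicit Arguments.
Unset Strict Implicit.
Unset Printing Implicit Defensive.

Import Order.TTheory.

(* [covers x y]: y is a cover of x. *)
Definition covers (d : Order.disp_t) (L : finTBLatticeType d) (x y : L) : bool :=
  (x < y)%O && [forall z : L, ~~ ((x < z)%O && (z < y)%O)].

Definition meet_irreducible (d : Order.disp_t) (L : finTBLatticeType d)
    (x : L) : bool :=
  (x != \top%O) && (#|[set y : L | covers x y]| == 1).

(* Equivalently, x is not the top and is not a meet of two other elements. *)
Lemma meet_irreducibleP (d : Order.disp_t) (L : finTBLatticeType d) (x : L) :
  meet_irreducible x <->
  x <> \top%O /\ (forall y z : L, x = (y `&` z)%O -> x = y \/ x = z).
Proof.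
have ex_cover (y : L) : (x < y)%O -> exists2 c, covers x c & (c <= y)%O.
  have [m] := ubnP #|[set z | (x < z <= y)%O]|.
  elim: m y => // m IH y lem lt_xy.
  have [cov|] := boolP (covers x y); first by exists y.
  rewrite /covers lt_xy /= => /forallPn [z /negPn /andP[xz zy]].
  have [|//|c cov cz] := IH z; last by exists c => //; apply: le_trans cz (ltW zy).
  apply: leq_trans (_ : _ < _) _; last exact: lem.
  apply/proper_card/properP; split.
    apply/subsetP => t; rewrite !inE => /andP[-> tz].
    exact: le_trans tz (ltW zy).
  by exists y; rewrite !inE lt_xy ?lexx // lt_geF.
split=> [/andP[/eqP xT /cards1P[c cE]]|[xT irr]].
  split=> // y z xyz.
  have le_xy : (x <= y)%O by rewrite xyz leIl.
  have le_xz : (x <= z)%O by rewrite xyz leIr.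
  have [->|nxy] := eqVneq x y; first by left.
  have [->|nxz] := eqVneq x z; first by right.
  have [c1 cov1 le1] := ex_cover y (ltac:(by rewrite lt_neqAle nxy)).
  have [c2 cov2 le2] := ex_cover z (ltac:(by rewrite lt_neqAle nxz)).
  have : c1 \in [set y : L | covers x y] by rewrite inE.
  have : c2 \in [set y : L | covers x y] by rewrite inE.
  rewrite cE !inE => /eqP e2 /eqP e1; subst c1 c2.
  have : (c <= x)%O by rewrite xyz lexI le1 le2.
  by case/andP: cov1 => /lt_geF ->.
apply/andP; split; first exact/eqP.
have [|c cov _] := ex_cover \top%O; first by rewrite lt_neqAle lex1 andbT; apply/eqP.
apply/cards1P; exists c; apply/setP => c'; rewrite !inE.
apply/idP/eqP => [cov'|-> //].
have /andP[xc /forallP nc] := cov; have /andP[xc' /forallP nc'] := cov'.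
have [xm|nxm] := eqVneq x (c `&` c')%O.
  by have [e|e] := irr _ _ xm; [rewrite -e ltxx in xc | rewrite -e ltxx in xc'].
have xm : (x < c `&` c')%O by rewrite lt_neqAle nxm lexI !ltW.
have := nc (c `&` c')%O; have := nc' (c `&` c')%O.
rewrite xm /= !lt_neqAle leIl leIr !andbT !negbK => /eqP e' /eqP e.
by rewrite -e' e.
Qed.

(* A point (x, y) of Z^2 with 0 <= x, y and x + y <= n has both coordinates in
   {0, ..., n}; subsets of Q(n) are therefore encoded as sets of points of the
   grid {0, ..., n} x {0, ..., n} that are included in [Qset n]. The grid is
   closed under coordinatewise min and max, so [pmin] and [pmax] below are the
   integer ones. *)
Definition point (n : nat) := ('I_n.+1 * 'I_n.+1)%type.

Definition Qset (n : nat) : {set point n} := [set p : point n | p.1 + p.2 <= n].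

Definition pmin (n : nat) (p q : point n) : point n :=
  (Order.min p.1 q.1, Order.min p.2 q.2).

Definition pmax (n : nat) (p q : point n) : point n :=
  (Order.max p.1 q.1, Order.max p.2 q.2).

Definition Rclosed (n : nat) (Y : {set point n}) : bool :=
  (Y \subset Qset n) &&
  [forall p : point n in Y, forall q : point n in Y,
    (maxn p.1 q.1 + maxn p.2 q.2 <= n.+1) ==>
    (pmin p q \in Y) && ((pmax p q \in Qset n) ==> (pmax p q \in Y))].

Record Rlat (n : nat) := MkRlat {
  Rset :> {set point n};
  RsetP : Rclosed Rset
}.

HB.instance Definition _ (n : nat) := [isSub for @Rset n].
HB.instance Definition _ (n : nat) := [Finite of Rlat n by <:].

Lemma RclosedP (n : nat) (Y : {set point n}) :
  reflect
    (Y \subset Qset n /\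
     forall p q : point n, p \in Y -> q \in Y ->
       maxn p.1 q.1 + maxn p.2 q.2 <= n.+1 ->
       pmin p q \in Y /\ (pmax p q \in Qset n -> pmax p q \in Y))
    (Rclosed Y).
Proof.
apply: (iffP andP) => -[sYQ cl]; split=> //.
  move=> p q pY qY le.
  have /forall_inP/(_ q qY)/implyP/(_ le)/andP[? /implyP ?] :=
    forall_inP cl p pY.
  by split.
apply/forall_inP => p pY; apply/forall_inP => q qY; apply/implyP => le.
by have [-> /implyP ->] := cl p q pY qY le.
Qed.

Lemma Rclosed_Q (n : nat) : Rclosed (Qset n).
Proof.
apply/RclosedP; split=> // p q; rewrite !inE => pQ qQ _; split=> //=.
apply: leq_trans pQ; apply: leq_add.
  have: (Order.min p.1 q.1 <= p.1)%O by rewrite ge_min lexx.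
  exact.
have: (Order.min p.2 q.2 <= p.2)%O by rewrite ge_min lexx.
  exact.
Qed.

Lemma Rclosed_0 (n : nat) : Rclosed (set0 : {set point n}).
Proof. by apply/RclosedP; split=> [|p q]; rewrite ?sub0set ?inE. Qed.

Lemma Rclosed_I (n : nat) (X Y : {set point n}) :
  Rclosed X -> Rclosed Y -> Rclosed (X :&: Y).
Proof.
move=> /RclosedP[sX cX] /RclosedP[_ cY]; apply/RclosedP; split.
  exact: subset_trans (subsetIl X Y) sX.
move=> p q; rewrite !inE => /andP[pX pY] /andP[qX qY] le.
have [mX MX] := cX p q pX qX le; have [mY MY] := cY p q pY qY le.
by rewrite mX mY; split=> // ?; rewrite MX ?MY // inE.
Qed.

Definition Rmeet (n : nat) (X Y : Rlat n) : Rlat n :=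
  MkRlat (Rclosed_I (RsetP X) (RsetP Y)).

Lemma Rclosed_join (n : nat) (X Y : Rlat n) :
  Rclosed (\bigcap_(Z : Rlat n | X :|: Y \subset Z) Rset Z).
Proof.
have sQ (Z : Rlat n) : Z \subset Qset n by case/RclosedP: (RsetP Z).
apply/RclosedP; split.
  have QP : X :|: Y \subset MkRlat (Rclosed_Q n) by rewrite subUset !sQ.
  exact: bigcap_inf QP.
move=> p q /bigcapP pI /bigcapP qI le.
have cl (Z : Rlat n) : X :|: Y \subset Z ->
    pmin p q \in Rset Z /\ (pmax p q \in Qset n -> pmax p q \in Rset Z).
  move=> ZP; have /RclosedP[_ clZ] := RsetP Z.
  exact: clZ (pI Z ZP) (qI Z ZP) le.
split=> [|MQ]; apply/bigcapP => Z /cl[] // _; exact.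
Qed.

Definition Rjoin (n : nat) (X Y : Rlat n) : Rlat n :=
  MkRlat (Rclosed_join X Y).

Fact Rlat_display : Order.disp_t. Proof. exact: Order.Disp tt tt. Qed.

Definition Rle (n : nat) (X Y : Rlat n) : bool := X \subset Y.

Lemma Rle_refl (n : nat) : reflexive (@Rle n).
Proof. by move=> X; apply: subxx. Qed.

Lemma Rle_anti (n : nat) : antisymmetric (@Rle n).
Proof. by move=> X Y XY; apply/val_inj/eqP; rewrite eqEsubset. Qed.

Lemma Rle_trans (n : nat) : transitive (@Rle n).
Proof. by move=> Y X Z; apply: subset_trans. Qed.

HB.instance Definition _ (n : nat) :=
  Order.Le_isPOrder.Build Rlat_display (Rlat n)
    (@Rle_refl n) (@Rle_anti n) (@Rle_trans n).

Lemma RlexI (n : nat) (X Y Z : Rlat n) :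
  (X <= Rmeet Y Z)%O = (X <= Y)%O && (X <= Z)%O.
Proof. exact: subsetI. Qed.

Lemma RleUx (n : nat) (X Y Z : Rlat n) :
  (Rjoin X Y <= Z)%O = (X <= Z)%O && (Y <= Z)%O.
Proof.
rewrite -[RHS]subUset; apply/idP/idP => [|XYZ]; last exact: bigcap_inf XYZ.
apply: subset_trans; apply/bigcapsP => W; exact.
Qed.

HB.instance Definition _ (n : nat) :=
  Order.POrder_isMeetSemilattice.Build Rlat_display (Rlat n) (@RlexI n).
HB.instance Definition _ (n : nat) :=
  Order.POrder_isJoinSemilattice.Build Rlat_display (Rlat n) (@RleUx n).

Lemma Rle0x (n : nat) (X : Rlat n) : (MkRlat (Rclosed_0 n) <= X)%O.
Proof. exact: sub0set. Qed.

Lemma RlexQ (n : nat) (X : Rlat n) : (X <= MkRlat (Rclosed_Q n))%O.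
Proof. by case/RclosedP: (RsetP X). Qed.

HB.instance Definition _ (n : nat) :=
  Order.hasBottom.Build Rlat_display (Rlat n) (@Rle0x n).
HB.instance Definition _ (n : nat) :=
  Order.hasTop.Build Rlat_display (Rlat n) (@RlexQ n).

(* The subtractions are truncated; these sets are meant for b <= n and d <= n. *)
Definition Vset (n a b : nat) : {set point n} :=
  [set p : point n in Qset n | (a <= p.1 <= b) && (p.2 <= n - b)].

Definition Hset (n c d : nat) : {set point n} :=
  [set p : point n in Qset n | (p.1 <= n - d) && (c <= p.2 <= d)].

(* Main.v *)
Require Import Defs.
From HB Require Import structures.
From mathcomp Require Import all_boot all_order.
From mathcomp Require Import zify.

Set Implicit Arguments.
Unset Strict Implicit.
Unset Printing Implicit Defensive.

Import Order.TTheory.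

(** The key point is that for every [Y] in R(n) and every [p = (x, y)] of Q(n)
    outside [Y] there is a [b] such that [V_(x,b)] or [H_(y,n-b)] contains [p]
    and is disjoint from [Y]. Otherwise [Y] meets both rectangles for all
    [x <= b <= n - y], and the maximum of a point of the one and a point of the
    other is a point [m_b] of [Y] with [p <= m_b <= (b, n - b)]. In particular
    [m_x] lies on the vertical line through [p]; as the maximum of a point below
    [(b, n - b)] and a point below [(b + 1, n - b - 1)] has coordinate sum at
    most [n + 1], taking successively the minimum with [m_(x+1)], [m_(x+2)], ...,
    [m_(n-y)] remains in [Y], and ends in [p].

    Hence every element of R(n) is an intersection of complements of rectangles
    V or H. Each such rectangle has a point that belongs to no smaller one of
    the family, so its complement is meet-irreducible. *)

Lemma pminE n (p q : point n) :
  ((pmin p q).1 = minn p.1 q.1 :> nat) * ((pmin p q).2 = minn p.2 q.2 :> nat).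
Proof.
have ltE (i j : 'I_n.+1) : (i < j)%O = (i < j) by [].
by split; rewrite /= /Order.min /minn ltE; case: ifP.
Qed.

Lemma pmaxE n (p q : point n) :
  ((pmax p q).1 = maxn p.1 q.1 :> nat) * ((pmax p q).2 = maxn p.2 q.2 :> nat).
Proof.
have ltE (i j : 'I_n.+1) : (i < j)%O = (i < j) by [].
by split; rewrite /= /Order.max /maxn ltE; case: ifP.
Qed.

Lemma point_ext n (p q : point n) :
  p.1 = q.1 :> nat -> p.2 = q.2 :> nat -> p = q.
Proof. by case: p q => [? ?] [? ?] /= /val_inj-> /val_inj->. Qed.

(** If the minimum is in V, one point lies to the right of V and the other above it, so the maximum
    has coordinate sum at least [n + 2]. If the maximum is in V, so is the point with the larger
    first coordinate. *)
Lemma Rclosed_QDV n a b : Rclosed (Qset n :\: Vset n a b).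
Proof.
apply/RclosedP; split=> [|p q]; first exact: subsetDl.
rewrite !inE !pminE !pmaxE => Hp Hq le; split=> [|HQ]; lia.
Qed.

Lemma Rclosed_QDH n c d : Rclosed (Qset n :\: Hset n c d).
Proof.
apply/RclosedP; split=> [|p q]; first exact: subsetDl.
rewrite !inE !pminE !pmaxE => Hp Hq le; split=> [|HQ]; lia.
Qed.

Lemma Rclosed_disjoint n (Y : {set point n}) (p : point n) :
    Rclosed Y -> p \in Qset n :\: Y ->
  exists b, [/\ p.1 <= b, b <= n - p.2 &
    [disjoint Vset n p.1 b & Y] \/ [disjoint Hset n p.2 (n - b) & Y]].
Proof.
move=> /RclosedP[sYQ cY] /setDP[]; rewrite inE => pQ pNY.
pose ok (b : 'I_n.+1) := [&& p.1 <= b, b <= n - p.2 &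
  [disjoint Vset n p.1 b & Y] || [disjoint Hset n p.2 (n - b) & Y]].
have [/existsP[b /and3P[pb bp /orP dis]]|/existsPn nok] := boolP [exists b, ok b].
  by exists b.
have below b : p.1 <= b -> b <= n - p.2 -> exists2 m : point n, m \in Y &
    [&& p.1 <= m.1, m.1 <= b, p.2 <= m.2 & m.2 <= n - b].
  move=> pb bp; have bn : b < n.+1 by lia.
  have := nok (Ordinal bn); rewrite /ok /= pb bp /= negb_or.
  case/andP=> /pred0Pn[v /andP[]]; rewrite !inE => vV vY.
  case/pred0Pn=> h /andP[]; rewrite !inE => hH hY.
  exists (pmax v h); last by rewrite !pmaxE; lia.
  by apply: (cY v h vY hY _).2; rewrite ?inE ?pmaxE; lia.
have descend k : p.1 + k <= n - p.2 -> exists2 m : point n, m \in Y &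
    [&& p.1 <= m.1, m.1 <= p.1, p.2 <= m.2 & m.2 <= n - (p.1 + k)].
  elim: k => [|k IHk] le.
    by have [m mY Hm] := below p.1 (leqnn _) ltac:(lia); exists m => //; lia.
  have [m mY Hm] := IHk ltac:(lia).
  have [m' mY' Hm'] := below (p.1 + k.+1) ltac:(lia) le.
  exists (pmin m m'); last by rewrite !pminE; lia.
  by apply: (cY m m' mY mY' _).1; lia.
(* For this number of minima the height bound [n - (p.1 + k)] is [p.2], which forces [m = p]. *)
have [m mY Hm] := descend (n - p.2 - p.1) ltac:(lia).
case/negP: pNY; suff <- : m = p by [].
by apply: point_ext; lia.
Qed.

(* As [V_(0,b) = H_(0,n-b)], the rectangles of the theorem are indexed by the
   pairs [c <= d] (for [H_(c,d)]) and [j < i] (for [V_(j+1,i)]). *)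
Definition rect n (k : point n) : {set point n} :=
  if k.1 <= k.2 then Hset n k.1 k.2 else Vset n k.2.+1 k.1.

(* Belongs to no rectangle strictly contained in [rect k]. *)
Definition rect_base n (k : point n) : point n :=
  if k.1 <= k.2 then (ord0, k.1) else (inord k.2.+1, ord0).

Lemma rect_sub n (k : point n) : rect k \subset Qset n.
Proof.
by rewrite /rect; case: ifP => _; apply/subsetP => p; rewrite inE => /andP[].
Qed.

Lemma Rclosed_QDrect n (k : point n) : Rclosed (Qset n :\: rect k).
Proof.
by rewrite /rect; case: ifP => _; [apply: Rclosed_QDH | apply: Rclosed_QDV].
Qed.

Definition corect n (k : point n) : Rlat n := MkRlat (Rclosed_QDrect k).

Lemma rect_baseE n (k : point n) :
  if k.1 <= k.2 then
    (rect_base k).1 = 0 :> nat /\ (rect_base k).2 = k.1 :> nat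
  else (rect_base k).1 = k.2.+1 :> nat /\ (rect_base k).2 = 0 :> nat.
Proof.
rewrite /rect_base; case: leqP => //= k21; rewrite inordK //.
by case: k k21 => [[i ?] [j ?]] /=; lia.
Qed.

Lemma rect_base_in n (k : point n) : rect_base k \in rect k.
Proof.
have := ltn_ord k.1; have := ltn_ord k.2; have := rect_baseE k; rewrite /rect.
by case: (leqP k.1) => kk [e1 e2] lt1 lt2; rewrite !inE e1 e2; lia.
Qed.

(** Both base points lie in both rectangles. This excludes one V and one H, as V has no point with
    first coordinate 0, and equates the lower bounds; the corner then equates the upper ones. *)
Lemma rect_base_min n (k k' : point n) :
  rect k \subset rect k' -> rect_base k' \in rect k -> k = k'.
Proof.
move=> /subsetP skk' w'k; have wk' := skk' _ (rect_base_in k).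
have [lt1 lt2] := (ltn_ord k.1, ltn_ord k.2).
have [lt1' lt2'] := (ltn_ord k'.1, ltn_ord k'.2).
(* The largest point of [rect k]; it lies on the line [x + y = n]. *)
pose corner : point n :=
  if k.1 <= k.2 then (inord (n - k.2), k.2) else (k.1, inord (n - k.1)).
have cornerE : if k.1 <= k.2 then
    corner.1 = n - k.2 :> nat /\ corner.2 = k.2 :> nat
    else corner.1 = k.1 :> nat /\ corner.2 = n - k.1 :> nat.
  by rewrite /corner; case: (leqP k.1) => _ /=; rewrite inordK // ltnS leq_subr.
have ck' : corner \in rect k'.
  apply: skk'; move: cornerE; rewrite /rect.
  by case: (leqP k.1) => kk [e1 e2]; rewrite !inE e1 e2; lia.
move: cornerE (rect_baseE k) (rect_baseE k') ck' wk' w'k; rewrite /rect.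
case: (leqP k.1) => kk; case: (leqP k'.1) => kk' [c1 c2] [w1 w2] [w1' w2'].
all: rewrite !inE c1 c2 w1 w2 w1' w2' => Hc Hw Hw'; apply: point_ext; lia.
Qed.

Lemma corect_inj n : injective (@corect n).
Proof.
move=> k k' /(congr1 (@Rset n)) /= /setP eqD.
have eqr : rect k = rect k'.
  apply/setP => p; have := eqD p; rewrite !in_setD.
  have := subsetP (rect_sub k) p; have := subsetP (rect_sub k') p.
  case: (p \in Qset n); first by rewrite !andbT => _ _ /negb_inj.
  by case: (p \in rect k) => [_ /(_ isT)//|]; case: (p \in rect k') => [/(_ isT)|].
by apply: rect_base_min; rewrite eqr // rect_base_in.
Qed.

Lemma corect_separates n (Y : Rlat n) (p : point n) :
  p \in Qset n :\: Y -> exists2 k, (Y <= corect k)%O & p \in rect k.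
Proof.
move=> pQY; have [sYQ _] := RclosedP _ (RsetP Y).
have leY k : [disjoint rect k & Y] -> (Y <= corect k)%O.
  move=> dis; apply/subsetP => q qY; rewrite inE (subsetP sYQ) // andbT.
  by apply: contraTN dis => qk; apply/pred0Pn; exists q; rewrite /= qk qY.
have [b [pb bp dis]] := Rclosed_disjoint (RsetP Y) pQY.
have pQ : p.1 + p.2 <= n by case/setDP: pQY; rewrite inE.
have inV : p \in Vset n p.1 b by rewrite !inE; lia.
have inH : p \in Hset n p.2 (n - b) by rewrite !inE; lia.
have VE : 0 < p.1 -> exists k, rect k = Vset n p.1 b.
  move=> p1; exists (inord b, inord p.1.-1).
  by rewrite /rect /= !inordK ?prednK //; [case: leqP => //; lia | lia..].
have HE : exists k, rect k = Hset n p.2 (n - b).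
  exists (p.2, inord (n - b)).
  by rewrite /rect /= !inordK; [case: leqP => //; lia | lia..].
have V0 : p.1 = 0 :> nat -> Vset n p.1 b = Hset n 0 (n - b).
  by move=> ->; apply/setP => q; rewrite !inE; lia.
case: dis => dis; last first.
  by have [k kE] := HE; exists k; [apply: leY|]; rewrite kE.
(* For [p.1 = 0] the rectangle [V_(0,b)] is indexed only as [H_(0,n-b)]. *)
have [p0|p1] := posnP p.1; last first.
  by have [k kE] := VE p1; exists k; [apply: leY|]; rewrite kE.
have kE : rect ((ord0, inord (n - b)) : point n) = Vset n p.1 b.
  by rewrite V0 // /rect /= inordK //; lia.
by exists (ord0, inord (n - b)); [apply: leY|]; rewrite kE.
Qed.

(** If [corect k] is a meet of two elements, one of them misses the base point. Separating the point
    from that element gives a rectangle inside [rect k] through its base, hence [rect k] itself. *)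
Lemma meet_irreducible_corect n (k : point n) : meet_irreducible (corect k).
Proof.
have base_out (Y : Rlat n) :
    (corect k <= Y)%O -> rect_base k \notin Rset Y -> corect k = Y.
  move=> leY out; have wk := rect_base_in k.
  have [|k' leYk' wk'] := @corect_separates n Y (rect_base k).
    by rewrite inE out (subsetP (rect_sub k)).
  have leD := le_trans leY leYk'.
  suff ek : k' = k by apply/le_anti; rewrite leY -{1}ek leYk'.
  apply: rect_base_min => //; apply/subsetP => q qk'; apply: contraTT qk' => qNk.
  have [qQ|qNQ] := boolP (q \in Qset n); last first.
    by apply: contraNN qNQ; apply/subsetP/rect_sub.
  by have := subsetP leD q; rewrite !in_setD qQ qNk => /(_ isT)/andP[].
apply/meet_irreducibleP; split=> [eT|Y Z eYZ].
  have : rect_base k \in Rset (corect k).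
    by rewrite eT; apply: (subsetP (rect_sub k)) (rect_base_in k).
  by rewrite in_setD rect_base_in.
have leY : (corect k <= Y)%O by rewrite eYZ leIl.
have leZ : (corect k <= Z)%O by rewrite eYZ leIr.
have : rect_base k \notin Rset (corect k) by rewrite in_setD rect_base_in.
rewrite {1}eYZ in_setI negb_and => /orP[] out; [left|right]; exact: base_out.
Qed.

Lemma meet_irreducible_bigmeet (d : Order.disp_t) (L : finTBLatticeType d)
    (x : L) (I : Type) (r : seq I) (P : pred I) (F : I -> L) :
  meet_irreducible x -> x = (\meet_(i <- r | P i) F i)%O ->
  exists2 i, P i & x = F i.
Proof.
move=> /meet_irreducibleP[xT irr]; elim: r => [|i r IHr]; first by rewrite big_nil.
rewrite big_cons; case: ifP => // Pi /irr[->|/IHr//].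
by exists i.
Qed.

(** By [corect_separates], each point of Q(n) missing from [Y] is missing from some factor. *)
Lemma bigmeet_corect n (Y : Rlat n) :
  Y = (\meet_(k : point n | Y <= corect k) corect k)%O.
Proof.
apply/le_anti/andP; split; first exact/meetsP.
apply/subsetP => p pM; apply: contraTT pM => pNY.
have [pQ|pNQ] := boolP (p \in Qset n); last first.
  by apply: contraNN pNQ; apply/subsetP; exact: RlexQ.
have [|k leYk pk] := @corect_separates n Y p; first by rewrite inE pNY.
have leM : (\meet_(k | Y <= corect k) corect k <= corect k)%O by exact: meets_inf.
by apply: contraL pk => /(subsetP leM); rewrite in_setD => /andP[].
Qed.

Lemma meet_irreducible_is_corect n (Y : Rlat n) :
  meet_irreducible Y = (Y \in [set corect k | k : point n]).
Proof.
apply/idP/imsetP => [irr|[k _ ->]]; last exact: meet_irreducible_corect.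
by have [k _ eYk] := meet_irreducible_bigmeet irr (bigmeet_corect Y); exists k.
Qed.

Theorem theorem26 (n : nat) :
  (forall X : {set point n},
    (exists2 Y : Rlat n, meet_irreducible Y & Rset Y = X) <->
    ((exists a b : nat,
        [/\ 1 <= a, a <= b, b <= n & X = Qset n :\: Vset n a b]) \/
     (exists c d : nat,
        [/\ c <= d, d <= n & X = Qset n :\: Hset n c d]))) /\
  #|[set Y : Rlat n | meet_irreducible Y]| = (n + 1) ^ 2.
Proof.
split=> [X|]; last first.
  (* The indices [k] range over the whole grid, not only over Q(n). *)
  rewrite -[LHS](_ : #|[set corect k | k : point n]| = _).
    by rewrite card_imset ?card_prod ?card_ord ?addn1 ?mulnn //; apply: corect_inj.
  by apply: eq_card => Y; rewrite in_set meet_irreducible_is_corect.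
split=> [[Y]|].
  rewrite meet_irreducible_is_corect => /imsetP[[i j] _ ->] <- /=; rewrite /rect /=.
  case: leqP => ij; [right|left].
    by exists i, j; split=> //; rewrite -ltnS.
  by exists j.+1, i; split=> //; rewrite -ltnS.
have witness k : X = Qset n :\: rect k ->
    exists2 Y : Rlat n, meet_irreducible Y & Rset Y = X.
  by move=> ->; exists (corect k); first exact: meet_irreducible_corect.
case=> [[a [b [a1 ab bn XE]]]|[c [d [cd dn XE]]]].
  (* The index [(i, j)] with [j < i] stands for [V_(j+1,i)], so [j = a - 1]. *)
  apply: (witness (inord b, inord a.-1)); rewrite XE /rect /= !inordK; [|lia..].
  by rewrite prednK //; case: leqP => //; lia.
apply: (witness (inord c, inord d)); rewrite XE /rect /= !inordK; [|lia..].
by rewrite cd.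
Qed.
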